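(* Let $m\geq 2$ be an integer, let $D_{2m}=\langle x,y\mid x^m=y^2=1,\ yxy=x^{-1}\rangle$ be the dihedral group of order $2m$, and let $\tau(m)$ denote the number of positive divisors of $m$. Then $$csd(D_{2m})=\begin{cases}\dfrac{\tau(m)(\tau(m)+m)+m(\tau(m)+1)}{(\tau(m)+m)^2}, & m\equiv 1 \pmod 2,\\[3mm] \dfrac{\tau(m)(\tau(m)+m)+m(\tau(m)+2)}{(\tau(m)+m)^2}, & m\equiv 0 \pmod 2.\end{cases}$$
   Context: For a finite group $G$, $L_1(G)$ denotes the set of all cyclic subgroups of $G$ (including the trivial subgroup), and the cyclic subgroup commutativity degree of $G$ is $$csd(G)=\frac{1}{|L_1(G)|^2}\left|\{(H,K)\in L_1(G)^2\mid HK=KH\}\right|,$$ where $HK=\{hk\mid h\in H,\,k\in K\}$ and the equality is an equality of sets. *)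

(* Defs.v *)
From mathcomp Require Import all_boot all_order all_fingroup all_algebra all_solvable.

Set Implicit Arguments.
Unset Strict Implicit.
Unset Printing Implicit Defensive.

Import GRing.Theory.

Section CyclicSubgroupCommutativityDegree.

Variables (gT : finGroupType) (G : {group gT}).

Definition L1 : {set {group gT}} := [set H in subgroups G | cyclic H].

(* The products are pointwise products of subsets, not joins of subgroups. *)
Definition commuting_pairs : {set {group gT} * {group gT}} :=
  [set HK in setX L1 L1 |
    ((HK.1 : {set gT}) * (HK.2 : {set gT}) ==
     (HK.2 : {set gT}) * (HK.1 : {set gT}))%g].

Definition csd : rat := (#|commuting_pairs|%:R / #|L1|%:R ^+ 2)%R.

End CyclicSubgroupCommutativityDegree.

Definition tau (m : nat) : nat := size (divisors m).

Definition is_dihedral (m : nat) (gT : finGroupType) (G : {group gT}) : Prop :=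
  (G \isog Grp (x : y : x ^+ m, y ^+ 2, y * x * y = x^-1))%g.

Lemma dihedral_is_dihedral (m : nat) :
  2 <= m -> is_dihedral m [set: 'D_(m.*2)]%G.
Proof.
move=> m_gt1 rT H; rewrite Grp_dihedral //.
apply: eq_existsb => -[x y] /=; rewrite !xpair_eqE.
congr (_ && _); congr (_ && _); apply: andb_id2l => /eqP y2.
have yV : (y^-1 = y)%g by apply/eqP; rewrite eq_invg_mul -expg2 y2.
by rewrite conjgE yV mulgA.
Qed.

(* Main.v *)
(**
The cyclic subgroups of the dihedral group are the tau(m) subgroups of the
rotation group X = <[x]> and the m subgroups <[t]> generated by a reflection t.
The former are characteristic in X, hence normal, and commute with everything.
Two subgroups <[s]>, <[t]> generated by reflections commute exactly when s and t
do; writing t = u s with u in X, this means u^2 = 1, which leaves one choice of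
t for each s if m is odd and two if m is even.
*)

Require Import Defs.
From mathcomp Require Import all_boot all_order all_fingroup all_algebra all_solvable.

Set Implicit Arguments.
Unset Strict Implicit.
Unset Printing Implicit Defensive.

Local Open Scope group_scope.

(** * From the presentation to generators *)

Lemma is_dihedral_card (m : nat) (gT : finGroupType) (G : {group gT}) :
  2 <= m -> is_dihedral m G -> #|G| = m.*2.
Proof.
move=> m_gt1 isoG; have isoD := dihedral_is_dihedral m_gt1.
(* Sharing a presentation, each group is a homomorphic image of the other. *)
have [homDG homGD]: ('D_(m.*2) \homg G) /\ (G \homg 'D_(m.*2)).
  by split; [rewrite isoG -isoD | rewrite isoD -isoG]; apply: homg_refl.
rewrite -(card_dihedral m_gt1).
by apply/eqP; rewrite eqn_leq !leq_homg.
Qed.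

(** The relations only bound the orders of [x] and [y] from above; that [G] has order [m.*2] rules
    out any collapse. *)
Lemma is_dihedral_generators (m : nat) (gT : finGroupType) (G : {group gT}) :
    2 <= m -> is_dihedral m G ->
  exists x y, [/\ <[x]> \subset G, y \in G :\: <[x]>, #[x] = m, y ^+ 2 = 1
                & x ^ y = x^-1].
Proof.
move=> m_gt1 isoG; have oG := is_dihedral_card m_gt1 isoG.
have /existsP[[x y] /=] : G \homg Grp (x : y : x ^+ m, y ^+ 2, y * x * y = x^-1).
  by rewrite -isoG homg_refl.
rewrite !xpair_eqE => /and4P[/eqP defG /eqP xm /eqP y2 /eqP yxy].
have xy : x ^ y = x^-1.
  rewrite -yxy conjgE mulgA; congr (_ * _ * _).
  by apply/eqP; rewrite eq_invg_mul -expg2 y2.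
have nXy : <[y]> \subset 'N(<[x]>).
  by rewrite cycle_subG; apply/normP; rewrite -cycleJ xy cycleV.
have defXY : <[x]> * <[y]> = G by rewrite -norm_joinEr.
have ox_le : #[x] <= m by rewrite dvdn_leq ?order_dvdn ?xm // ltnW.
have oy_le : #[y] <= 2 by rewrite dvdn_leq ?order_dvdn ?y2.
have Gx : <[x]> \subset G by rewrite -defXY mulG_subl.
have Gy : y \in G by rewrite -cycle_subG -defXY mulG_subr.
have X'y : y \notin <[x]>.
  apply: contraL ox_le => Xy; rewrite -ltnNge.
  have -> : #[x] = m.*2 by rewrite -oG -defXY mulGSid // cycle_subG.
  by rewrite -addnn -[X in X < _]addn0 ltn_add2l ltnW.
exists x, y; split; rewrite ?inE ?X'y //.
(* [G = <[x]> * <[y]>] has at most [#[x] * 2] elements, so [m <= #[x]]. *)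
apply/eqP; rewrite eqn_leq ox_le -(leq_pmul2r (isT : 0 < 2)) muln2 -oG -defXY.
apply: leq_trans (_ : #[x] * #[y] <= _); last by rewrite leq_pmul2l.
by rewrite !orderE mul_cardG leq_pmulr ?cardG_gt0.
Qed.

(** * Counting in a cyclic group *)

Lemma card_subgroups_cycle (gT : finGroupType) (x : gT) :
  #|subgroups <[x]>| = tau #[x].
Proof.
rewrite /tau -(size_map (fun d => <[x ^+ (#[x] %/ d)]>%G)).
have inj : {in divisors #[x] &, injective (fun d => <[x ^+ (#[x] %/ d)]>%G)}.
  move=> d e; rewrite -!dvdn_divisors // => dx ex [] eq_de.
  suff oX k : k %| #[x] -> #[x ^+ (#[x] %/ k)] = k.
    by rewrite -(oX d) // -(oX e) // /order eq_de.
  by move=> kx; rewrite orderXdiv ?dvdn_div // divnA // mulKn.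
rewrite -(card_uniqP _); last by rewrite map_inj_in_uniq ?divisors_uniq.
(* A cyclic group has only one subgroup of each order, so the list is complete. *)
apply: eq_card => H; rewrite inE; apply/idP/mapP => [sHX | [d _ ->]].
  exists #|H|; first by rewrite -dvdn_divisors // cardSg.
  apply/set1P; rewrite -cycle_sub_group ?cardSg //.
  by rewrite inE sHX eqxx.
by rewrite cycle_subG mem_cycle.
Qed.

(** The source of the parity split: for even order the solutions form the unique subgroup of order
    2. *)
Lemma card_square_roots_cycle (gT : finGroupType) (x : gT) :
  #|[set u in <[x]> | u ^+ 2 == 1]| = (if odd #[x] then 1 else 2)%N.
Proof.
case: ifPn => [odd_x | even_x].
  apply: (@eq_card1 _ 1%g) => u; rewrite !inE.
  apply/andP/eqP => [[Xu u2] | ->]; last by rewrite group1 expg1n.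
  have: #[u] %| gcdn 2 #[x] by rewrite dvdn_gcd order_dvdn u2 order_dvdG.
  by rewrite (eqP (_ : coprime 2 #[x])) ?coprime2n // dvdn1 order_eq1 => /eqP.
have x2 : 2 %| #[x] by rewrite dvdn2.
have oz : #[x ^+ #[x]./2] = 2.
  by rewrite -divn2 orderXdiv ?dvdn_div // divnA // mulKn.
rewrite -[RHS]oz; apply: eq_card => u; rewrite inE.
apply/andP/idP => [[Xu u2] | Zu]; last first.
  split; first by apply: subsetP Zu; rewrite cycle_subG mem_cycle.
  by rewrite -order_dvdn -oz order_dvdG.
by rewrite -cycle_subG -(cardSg_cyclic (cycle_cyclic x)) ?cycle_subG ?mem_cycle //
   -!orderE oz order_dvdn.
Qed.

(** * Rotations and reflections *)

Section Dihedral.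

Variables (gT : finGroupType) (G : {group gT}) (x y : gT).
Hypotheses (sXG : <[x]> \subset G) (GX'y : y \in G :\: <[x]>).
Hypotheses (oG : #|G| = #[x].*2) (y2 : y ^+ 2 = 1) (xy : x ^ y = x^-1).

Let X := <[x]>.
(** Not the set of involutions: [X] itself contains one when [#[x]] is even. *)
Let reflections := G :\: X.
Let reflection_subgroups := [set <[t]>%G | t in reflections].

Lemma card_reflections : #|reflections| = #[x].
Proof.
by rewrite cardsD (setIidPr sXG) oG -addnn addnK.
Qed.

Lemma rotations_normal : X <| G.
Proof.
apply: index2_normal => //.
by rewrite -divgS // oG -muln2 mulKn ?order_gt0.
Qed.

Lemma reflectionsE : reflections = X :* y.
Proof.
apply/esym/eqP; rewrite eqEcard card_rcoset card_reflections leqnn andbT.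
apply/subsetP => _ /rcosetP[u Xu ->]; move: GX'y; rewrite !inE => /andP[X'y Gy].
by rewrite groupMl // X'y groupM // (subsetP sXG).
Qed.

(** A reflection is a rotation times [y]; the rotation centralises the abelian group [X], so only
    the inversion by [y] remains. *)
Lemma reflection_conj (t u : gT) : t \in reflections -> u \in X -> u ^ t = u^-1.
Proof.
rewrite reflectionsE => /rcosetP[_ /cycleP[j ->] ->] /cycleP[i ->].
have xij : (x ^+ i) ^ (x ^+ j) = x ^+ i.
  by rewrite conjgE (commuteX2 i j (commute_refl x)) mulKg.
by rewrite conjgM xij conjXg xy expgVn.
Qed.

Lemma reflection_sqr (t : gT) : t \in reflections -> t ^+ 2 = 1.
Proof.
rewrite reflectionsE => /rcosetP[u Xu ->].
have yV : y^-1 = y by apply/eqP; rewrite eq_invg_mul -expg2 y2.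
(* Since [y] is its own inverse, the square of [u * y] is [u * u ^ y]. *)
have : u ^ y = u^-1 by rewrite reflection_conj.
by rewrite conjgE yV expg2 -mulgA => ->; rewrite mulgV.
Qed.

Lemma order_reflection (t : gT) : t \in reflections -> #[t] = 2.
Proof.
move=> Rt; apply/prime.prime_nt_dvdP; rewrite ?order_dvdn ?reflection_sqr //.
by apply: contraTneq Rt => /eqP; rewrite order_eq1 inE => /eqP->; rewrite group1.
Qed.

Lemma reflection_cycle_set (t : gT) : t \in reflections -> <[t]> = [set 1; t].
Proof. by move=> Rt; apply: cycle2g; apply: order_reflection. Qed.

Lemma reflection_cycle_inj : {in reflections &, injective (fun t => <[t]>%G)}.
Proof.
move=> s t Rs Rt [] eq_st; have: s \in [set 1; t].
  by rewrite -reflection_cycle_set // -eq_st cycle_id.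
by case/set2P=> // s1; move: (order_reflection Rs); rewrite s1 order1.
Qed.

Lemma card_reflection_subgroups : #|reflection_subgroups| = #[x].
Proof. by rewrite (card_in_imset reflection_cycle_inj) card_reflections. Qed.

(** * The cyclic subgroups of [G] *)

Lemma L1E : L1 G = subgroups X :|: reflection_subgroups.
Proof.
apply/setP=> H; rewrite !inE; apply/andP/orP => [[sHG /cyclicP[t defH]] | [sHX | ]].
- have Gt : t \in G by rewrite -cycle_subG -defH.
  have [Xt | X't] := boolP (t \in X); first by left; rewrite defH cycle_subG.
  right; apply/imsetP; exists t; first by rewrite inE X't.
  exact: val_inj.
- by rewrite (subset_trans sHX sXG) (cyclicS sHX (cycle_cyclic x)).
by case/imsetP=> t /setDP[Gt _] ->; rewrite cycle_subG Gt cycle_cyclic.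
Qed.

Lemma rotation_reflection_disjoint :
  [disjoint subgroups X & reflection_subgroups].
Proof.
apply/pred0P=> H /=; apply/negP=> /andP[]; rewrite inE => sHX /imsetP[t Rt defH].
by case/setDP: Rt => _ /negP[]; rewrite -cycle_subG -[<[t]>]/(val <[t]>%G) -defH.
Qed.

Lemma card_L1 : #|L1 G| = tau #[x] + #[x].
Proof.
rewrite L1E cardsU disjoint_setI0 ?rotation_reflection_disjoint // cards0 subn0.
by rewrite card_subgroups_cycle card_reflection_subgroups.
Qed.

(** * Commuting pairs *)

Lemma rotation_subgroup_commutes (H K : {group gT}) :
  H \subset X -> K \subset G -> H * K = K * H.
Proof.
move=> sHX sKG; apply/esym/normC.
have nHG : H <| G.
  by rewrite (char_normal_trans _ rotations_normal) ?sub_cyclic_char ?cycle_cyclic.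
exact: subset_trans sKG (normal_norm nHG).
Qed.

Lemma reflection_subgroups_commute (s t : gT) :
    s \in reflections -> t \in reflections ->
  (<[s]> * <[t]> == <[t]> * <[s]>) = (s * t == t * s).
Proof.
move=> Rs Rt; apply/eqP/eqP => [eq_st | cst]; last first.
  by apply: normC; rewrite cents_norm // cent_cycle cycle_subG; apply/cent1P.
have [s1 t1] : s != 1 /\ t != 1.
  by rewrite -!order_gt1 !order_reflection.
have: s * t \in <[t]> * <[s]> by rewrite -eq_st mem_mulg ?cycle_id.
rewrite !reflection_cycle_set //.
(* [s * t] is [1], [s], [t] or [t * s]: the first gives [s = t^-1], the next two make a reflection
   trivial, the last is the claim. *)
case/mulsgP=> _ _ /set2P[]-> /set2P[]->; rewrite ?mulg1 ?mul1g // => st.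
- by rewrite (eqP (_ : s == t^-1)) ?mulgV ?mulVg // eq_mulgV1 invgK st.
- by case/eqP: t1; apply: (mulgI s); rewrite mulg1.
- by case/eqP: s1; apply: (mulIg t); rewrite mul1g.
Qed.

Definition commuting_reflections :=
  [set st in setX reflections reflections | st.1 * st.2 == st.2 * st.1].

Lemma card_commuting_reflections :
  #|commuting_reflections| = (#[x] * (if odd #[x] then 1 else 2))%N.
Proof.
rewrite -card_square_roots_cycle -card_reflections -sum_nat_const.
rewrite -sum1_card /commuting_reflections.
rewrite (eq_bigl (fun st => (st.1 \in reflections) &&
   ((st.2 \in reflections) && (st.1 * st.2 == st.2 * st.1)))); last first.
  by case=> s t; rewrite in_set in_setX andbA.
rewrite -(pair_big_dep (mem reflections)
  (fun s t => (t \in reflections) && (s * t == t * s)) (fun _ _ => 1%N)) /=.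
apply: eq_bigr => s Rs; rewrite sum1_card.
have Gs : s \in G by case/setDP: Rs.
(* For fixed [s], right multiplication by [s] maps the square roots of 1 in [X] bijectively onto the
   reflections commuting with [s]. *)
rewrite -[RHS](card_imset _ (mulIg s)); apply: eq_card => t.
rewrite unfold_in; apply/andP/imsetP => [[Rt /eqP cst] | [u]].
  exists (t * s^-1); last by rewrite mulgKV.
  rewrite inE -mem_rcoset; apply/andP; split.
    by move: Rs Rt; rewrite reflectionsE => /rcoset_eqP->.
  rewrite expgMn; last exact: commuteV.
  by rewrite expgVn !reflection_sqr // invg1 mulg1.
rewrite inE => /andP[Xu /eqP u2] ->.
have uV : u^-1 = u by apply/eqP; rewrite eq_invg_mul -expg2 u2.
have cus : commute u s.
  (* Conjugation by [s] inverts [u], hence fixes it. *)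
  by apply/commgP/conjg_fixP; rewrite reflection_conj.
split; last by rewrite mulgA cus.
move: Rs; rewrite reflectionsE => /rcosetP[v Xv ->].
by rewrite mulgA mem_rcoset mulgK groupM.
Qed.

(** Split by which components lie in [X]. The second piece takes its first component among the
    reflection subgroups only, which keeps the three pieces disjoint. *)
Lemma commuting_pairsE :
  commuting_pairs G = setX (subgroups X) (L1 G) :|:
   (setX reflection_subgroups (subgroups X) :|:
    [set (<[st.1]>%G, <[st.2]>%G) | st in commuting_reflections]).
Proof.
have rotG (H : {group gT}) : H \in subgroups X -> H \subset G.
  by rewrite inE => /subset_trans; apply.
have reflG (H : {group gT}) : H \in reflection_subgroups -> H \subset G.
  by case/imsetP=> t /setDP[Gt _] ->; rewrite cycle_subG.
have rotC (H K : {group gT}) : H \in subgroups X -> K \subset G -> H * K == K * H.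
  by rewrite inE => sHX sKG; rewrite rotation_subgroup_commutes.
apply/setP=> -[H K]; rewrite in_setU in_setU in_set !in_setX /= L1E !in_setU.
set both_refl := (H, K) \in _.
have both_reflP : both_refl ->
  (H \in reflection_subgroups) && (K \in reflection_subgroups).
  rewrite /both_refl => /imsetP[[s t]]; rewrite in_set in_setX /=.
  case/andP=> /andP[Rs Rt] _ [-> ->].
  by rewrite !imset_f.
(* With [H] inside [X] commutation is automatic, and only the membership of [K] in [L1 G] is at
   stake. *)
have [rotH | _] := boolP (H \in subgroups X).
  rewrite /=; apply/idP/idP=> [/andP[-> //] | allK].
  have LK : (K \in subgroups X) || (K \in reflection_subgroups).
    by case/or3P: allK => [// | /andP[_ ->] // | /both_reflP/andP[_ ->]]; rewrite orbT.
  by rewrite LK rotC //; case/orP: LK => [/rotG | /reflG].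
have [rotK | _] := boolP (K \in subgroups X).
  rewrite /= !andbT; apply/andP/orP => [[-> _] | allH]; first by left.
  have RH : H \in reflection_subgroups by case: allH => // /both_reflP/andP[].
  by split=> //; rewrite eq_sym rotC ?reflG.
(* Neither component lies in [X]: commutation is that of the generators. *)
rewrite /= andbF /= /both_refl; apply/andP/idP => [[/andP[]] | both].
  case/imsetP=> s Rs -> /imsetP[t Rt ->].
  rewrite reflection_subgroups_commute // => cst.
  by apply/imsetP; exists (s, t) => //; rewrite in_set in_setX /= Rs Rt.
split; first exact: both_reflP.
case/imsetP: both => -[s t]; rewrite in_set in_setX /=.
by case/andP=> /andP[Rs Rt] cst [-> ->]; rewrite reflection_subgroups_commute.
Qed.

Lemma card_commuting_pairs :
  #|commuting_pairs G| =
    (tau #[x] * (tau #[x] + #[x]) +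
     #[x] * (tau #[x] + if odd #[x] then 1 else 2))%N.
Proof.
have disj := rotation_reflection_disjoint.
have notin_rot H : H \in reflection_subgroups -> (H \in subgroups X) = false.
  exact: disjointFl.
rewrite commuting_pairsE cardsU disjoint_setI0 ?cards0 ?subn0; last first.
  apply/pred0P=> -[H K] /=; apply/negP=> /andP[]; rewrite in_setX => /andP[rotH _].
  case/setUP=> [|/imsetP[[s t]]]; first by rewrite in_setX => /andP[/notin_rot/negP].
  rewrite in_set in_setX /= => /andP[/andP[Rs _] _] [defH _].
  by move: rotH; rewrite defH notin_rot ?imset_f.
rewrite cardsU disjoint_setI0 ?cards0 ?subn0; last first.
  apply/pred0P=> -[H K] /=; apply/negP=> /andP[]; rewrite in_setX => /andP[_ rotK].
  case/imsetP=> -[s t]; rewrite in_set in_setX /= => /andP[/andP[_ Rt] _] [_ defK].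
  by move: rotK; rewrite defK notin_rot ?imset_f.
(* A reflection is determined by the subgroup it generates, so pairs of subgroups are counted by
   pairs of reflections. *)
rewrite card_in_imset.
  rewrite !cardsX card_L1 card_subgroups_cycle card_reflection_subgroups.
  by rewrite card_commuting_reflections !mulnDr.
have reflP s t : (s, t) \in commuting_reflections ->
  s \in reflections /\ t \in reflections.
  by rewrite in_set in_setX => /andP[/andP].
move=> [s t] [s' t'] /reflP[Rs Rt] /reflP[Rs' Rt'] [eq_s eq_t].
by congr (_, _); apply: reflection_cycle_inj => //; apply: val_inj.
Qed.

End Dihedral.

Theorem theorem3p2p1 (m : nat) (gT : finGroupType) (G : {group gT}) :
  2 <= m -> is_dihedral m G ->
  csd G =
    (if odd m then
       ((tau m)%:R * ((tau m)%:R + m%:R) + m%:R * ((tau m)%:R + 1))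
         / ((tau m)%:R + m%:R) ^+ 2
     else
       ((tau m)%:R * ((tau m)%:R + m%:R) + m%:R * ((tau m)%:R + 2))
         / ((tau m)%:R + m%:R) ^+ 2)%R.
Proof.
move=> m_gt1 isoG; have oG := is_dihedral_card m_gt1 isoG.
have [x [y [sXG X'y ox y2 xy]]] := is_dihedral_generators m_gt1 isoG.
(* Trades [m] for [#[x]], in which the counts are expressed. *)
rewrite -ox in oG *.
rewrite /csd (card_commuting_pairs sXG X'y) // (card_L1 sXG X'y) //.
by case: odd; rewrite !(GRing.natrD, GRing.natrM).
Qed.
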